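(* Let $p_1,p_2$ be primes with $\{p_1 \bmod 4,\ p_2 \bmod 4\}=\{1,3\}$, let $m\geq 1$ be an integer, and put $N=p_1^m p_2$ and $d=p_1p_2$. Let $p$ be a prime with $\gcd(p,N)=1$ such that $\mathrm{ord}_{p_1^m}(p)=\phi(p_1^m)$, $\mathrm{ord}_{p_2}(p)=\phi(p_2)$ and $f:=\mathrm{ord}_N(p)=\phi(N)/2$. Let $q=p^f$, let $\gamma$ be a primitive element of $\mathbb{F}_q$, let $C_0=\langle \gamma^N\rangle$ and $C_i=\gamma^i C_0$ for $i\in\mathbb{Z}$ (indices taken modulo $N$). For $0\leq k\leq d-1$ define $$D_k=\bigcup_{i=0}^{p_1^{m-1}-1} C_{ip_2+kp_1^{m-1}}.$$ Define $R'_0=\{(x,x)\mid x\in\mathbb{F}_q\}$ and, for $1\leq k\leq d$, $R'_k=\{(x,y)\mid x,y\in\mathbb{F}_q,\ x-y\in D_{k-1}\}$. Then $(\mathbb{F}_q,\{R'_k\}_{0\leq k\leq d})$ is a pseudocyclic association scheme.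
   Context: An association scheme with $d$ classes on a finite set $X$ is a partition $R_0=\{(x,x)\},R_1,\dots,R_d$ of $X\times X$ such that each $R_i$ is symmetric and, for all $i,j,k$, the number of $z$ with $(x,z)\in R_i$, $(z,y)\in R_j$ depends only on $k$ where $(x,y)\in R_k$ (here all schemes are commutative and symmetric). Let $E_0=\frac{1}{|X|}J,E_1,\dots,E_d$ be the primitive idempotents of its Bose–Mesner algebra (the algebra spanned by the adjacency matrices of the $R_i$). The scheme is pseudocyclic if there is an integer $t$ with $\mathrm{rank}(E_i)=t$ for all $1\leq i\leq d$. $\mathrm{ord}_n(p)$ denotes the multiplicative order of $p$ modulo $n$ and $\phi$ is Euler's totient function. *)

(* Defs.v *)
From HB Require Import structures.
From mathcomp Require Import all_boot all_order all_fingroup all_algebra all_solvable.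
Set Implicit Arguments. Unset Strict Implicit. Unset Printing Implicit Defensive.
Import GRing.Theory.
Local Open Scope ring_scope.

Section AssociationScheme.
Variables (X : finType) (d : nat) (R : 'I_d.+1 -> {set X * X}).

Definition partition_family : Prop :=
  [/\ forall i, R i != set0,
      forall i j, i != j -> [disjoint R i & R j]
    & \bigcup_i R i = [set: X * X]].

Definition association_scheme : Prop :=
  [/\ partition_family,
      R ord0 = [set xy : X * X | xy.1 == xy.2],
      forall i x y, (x, y) \in R i -> (y, x) \in R i
    & forall i j k, exists n : nat, forall x y, (x, y) \in R k ->
        #|[set z | ((x, z) \in R i) && ((z, y) \in R j)]| = n].

Variable C : numClosedFieldType.

(* Rows and columns are indexed by X through the enumeration enum_val. *)
Definition adjacency_mx (k : 'I_d.+1) : 'M[C]_#|X| :=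
  \matrix_(i, j) ((enum_val i, enum_val j) \in R k)%:R.

Definition bose_mesner : {vspace 'M[C]_#|X|} := <<codom adjacency_mx>>%VS.

Definition bm_idempotent (E : 'M[C]_#|X|) : Prop :=
  E \in bose_mesner /\ E *m E = E.

Definition bm_primitive_idempotent (E : 'M[C]_#|X|) : Prop :=
  [/\ bm_idempotent E, E != 0
    & forall E1 E2, bm_idempotent E1 -> bm_idempotent E2 ->
        E1 *m E2 = 0 -> E2 *m E1 = 0 -> E = E1 + E2 -> E1 = 0 \/ E2 = 0].

Definition primitive_idempotents (E : 'I_d.+1 -> 'M[C]_#|X|) : Prop :=
  [/\ E ord0 = const_mx (#|X|%:R^-1),
      injective E
    & forall M, bm_primitive_idempotent M <-> exists i, M = E i].

Definition pseudocyclic : Prop :=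
  exists2 E : 'I_d.+1 -> 'M[C]_#|X|, primitive_idempotents E &
    exists t : nat, forall i, i != ord0 -> \rank (E i) = t.

End AssociationScheme.

(* Meaningful only for n > 1 and a coprime to n: for n <= 1 the type 'Z_n is
   Z/2Z, and insubd falls back to the unit 1 when a is not invertible. *)
Definition ord_mod (n a : nat) : nat := #[insubd (1%g : {unit 'Z_n}) a%:R]%g.

Section Cyclotomy.
Variables (F : finFieldType) (g : {unit F}).

Definition cyclotomic_class (N i : nat) : {set F} :=
  [set val u | u in (g ^+ i *: <[g ^+ N]>)%g].

Definition D_class (p1 p2 m k : nat) : {set F} :=
  (\bigcup_(i < p1 ^ (m - 1))
     cyclotomic_class (p1 ^ m * p2) (i * p2 + k * p1 ^ (m - 1)))%N.

Definition fusion_rel (p1 p2 m : nat) (k : 'I_(p1 * p2).+1) : {set F * F} :=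
  if k == ord0 then [set xy : F * F | xy.1 == xy.2]
  else [set xy : F * F | xy.1 - xy.2 \in D_class p1 p2 m k.-1].

End Cyclotomy.
Arguments fusion_rel {F} g p1 p2 m k.

(* Main.v *)
Require Import Defs.
From HB Require Import structures.
From mathcomp Require Import all_boot all_order all_fingroup all_algebra all_solvable.
From mathcomp Require Import all_field zify ring.
Set Implicit Arguments. Unset Strict Implicit. Unset Printing Implicit Defensive.
Import GRing.Theory Num.Theory.

(* Put P = p1^(m-1) and d = p1 p2, so N = P d, and let psi be an additive character
   of F invariant under x |-> x^p. The Gauss period S(a) = sum of psi over C_a depends
   only on the orbit of a mod N under multiplication by p. The subgroup <p> has index 2
   in (Z/N)^*, so it contains the units congruent to 1 mod d, which form a group of odd
   order; if P does not divide b, some such unit sends b to b + P p2, hence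
   S(b + P p2) = S(b). Therefore the character value f(b) = psi(gamma^b D_0), which is
   S(b) + S(b + p2) + ... + S(b + (P-1) p2), satisfies f(b + p2) = f(b) unless P divides
   b. Writing b + i p2 = e P mod N with 0 <= i < P, we get f(b) = f(e P), and
   psi(gamma^b D_k) = f(b + k P) = f((e + k) P) depends only on k and the "dual class"
   e mod d of gamma^b. So the Fourier transform maps functions constant on {0} and the
   D_k injectively into functions constant on {0} and the d dual classes; the dimensions
   agree, hence the former are closed under convolution, and the primitive idempotents
   are the inverse transforms of the indicators of the dual classes, which all have
   the cardinality of D_0. *)

Local Open Scope ring_scope.

(** * Translation schemes and their duals *)

Lemma rank_diag_mx (K : fieldType) n (v : 'rV[K]_n) :
  \rank (diag_mx v) = (\sum_i (v 0%R i != 0%R))%N.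
Proof.
elim: n v => [|n IH] v; first by rewrite flatmx0 mxrank0 big_ord0.
move: v; rewrite -[n.+1]/(1 + n)%N => v.
rewrite -[v]hsubmxK diag_mx_row rank_diag_block_mx IH.
rewrite big_split_ord /=; congr (_ + _)%N; last first.
  by apply: eq_bigr => i _; rewrite row_mxEr.
rewrite big_ord_recl big_ord0 addn0 row_mxEl rank_rV; congr (nat_of_bool (~~ _)).
apply/eqP/eqP => [/rowP/(_ 0)|e]; first by rewrite !mxE eqxx.
by apply/rowP => i; rewrite !mxE !ord1 in e *; rewrite e mul0rn.
Qed.

(** * Matrices diagonalised by the additive characters of [F] *)

Section Fourier.
Variables (F : finFieldType) (C : numClosedFieldType) (psi : F -> C).
Hypotheses (psi0 : psi 0 = 1) (psiD : forall x y, psi (x + y) = psi x * psi y).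
Hypothesis psi_nontrivial : exists x, psi x != 1.

(** Orthogonality: for [y != 0], translating the summation variable by [x0 / y] multiplies the sum
    by [psi x0 != 1], so the sum vanishes. *)
Lemma sum_char y : \sum_x psi (x * y) = if y == 0 then #|F|%:R else 0.
Proof.
case: eqP => [->|/eqP y0].
  under eq_bigr do rewrite mulr0 psi0.
  by rewrite sumr_const.
have [x0 nx0] := psi_nontrivial.
set s := \sum_x _; suff : (1 - psi x0) * s = 0.
  by move/eqP; rewrite mulf_eq0 subr_eq0 eq_sym (negbTE nx0) => /eqP.
rewrite mulrBl mul1r mulr_sumr {1}/s (reindex_inj (addrI (x0 / y))) /= -sumrB.
by rewrite big1 // => x _; rewrite mulrDl divfK // psiD subrr.
Qed.

Let n := #|F|.
Let ev : 'I_n -> F := @enum_val F F.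

Let n0 : n%:R != 0 :> C.
Proof. by rewrite pnatr_eq0 -lt0n; apply/card_gt0P; exists 0. Qed.

Definition fourier_mx : 'M[C]_n := \matrix_(i, j) psi (ev i * ev j).
Definition fourier_inv_mx : 'M[C]_n := \matrix_(i, j) (n%:R^-1 * psi (- (ev i * ev j))).
(** The operator with eigenvalue [l y] on the character [x |-> psi (x * y)]. *)
Definition spectral_mx (l : F -> C) : 'M[C]_n :=
  fourier_mx *m diag_mx (\row_i l (ev i)) *m fourier_inv_mx.

Lemma sum_ev (f : F -> C) : \sum_i f (ev i) = \sum_x f x.
Proof. by rewrite (reindex _ (onW_bij _ (enum_val_bij F))). Qed.

Lemma fourier_mxK : fourier_mx *m fourier_inv_mx = 1%:M.
Proof.
apply/matrixP => i j; rewrite !mxE.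
under eq_bigr => k _ do rewrite !mxE mulrCA -psiD (mulrC (ev i)) -mulrBr.
rewrite -mulr_sumr (sum_ev (fun y => psi (y * _))) sum_char subr_eq0.
by rewrite (inj_eq enum_val_inj); case: eqP => _; rewrite ?mulVf ?mulr0.
Qed.

Lemma spectral_mxE l i j :
  spectral_mx l i j = n%:R^-1 * \sum_y l y * psi (y * (ev i - ev j)).
Proof.
rewrite mxE -(sum_ev (fun y => l y * _)) mulr_sumr; apply: eq_bigr => k _.
rewrite mul_mx_diag !mxE mulrBr psiD (mulrC (ev k) (ev i)).
by ring.
Qed.

Lemma spectral_mxM l l' :
  spectral_mx l *m spectral_mx l' = spectral_mx (fun y => l y * l' y).
Proof.
rewrite /spectral_mx !mulmxA -(mulmxA _ fourier_inv_mx) (mulmx1C fourier_mxK).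
rewrite mulmx1; congr (_ *m _); rewrite -!mulmxA; congr (_ *m _).
rewrite mulmx_diag; congr diag_mx; by apply/rowP => i; rewrite !mxE.
Qed.

Lemma spectral_mx_inj l l' : spectral_mx l = spectral_mx l' -> l =1 l'.
Proof.
move=> /(congr1 (fun M => fourier_inv_mx *m M *m fourier_mx)).
rewrite /spectral_mx !mulmxA (mulmx1C fourier_mxK) !mul1mx.
rewrite -!mulmxA (mulmx1C fourier_mxK) !mulmx1 => e x.
have := congr1 (fun M : 'M_n => M (enum_rank x) (enum_rank x)) e.
by rewrite !mxE eqxx !mulr1n /ev enum_rankK.
Qed.

Lemma eq_spectral_mx l l' : l =1 l' -> spectral_mx l = spectral_mx l'.
Proof.
move=> e; rewrite /spectral_mx; congr (_ *m diag_mx _ *m _).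
by apply/rowP => i; rewrite !mxE.
Qed.

Lemma spectral_mxD l l' :
  spectral_mx l + spectral_mx l' = spectral_mx (fun y => l y + l' y).
Proof.
rewrite /spectral_mx -mulmxDl -mulmxDr -raddfD; congr (_ *m diag_mx _ *m _).
by apply/rowP => i; rewrite !mxE.
Qed.

Lemma spectral_mx0 l : l =1 (fun => 0) -> spectral_mx l = 0.
Proof.
move=> l0; apply/matrixP => i j; rewrite spectral_mxE mxE big1 ?mulr0 // => y _.
by rewrite l0 mul0r.
Qed.

Lemma spectral_mx_eq0 l : spectral_mx l = 0 -> l =1 (fun => 0).
Proof. by rewrite -(@spectral_mx0 (fun => 0)) // => /spectral_mx_inj. Qed.

Lemma rank_spectral_mx l : \rank (spectral_mx l) = #|[set y | l y != 0]|.
Proof.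
have [Uu Wu] := mulmx1_unit fourier_mxK.
rewrite mxrankMfree ?row_free_unit // (eqmxMfull _ _) ?row_full_unit //.
rewrite rank_diag_mx -sum1dep_card [RHS]big_mkcond /=.
rewrite [RHS](reindex _ (onW_bij _ (enum_val_bij F))) /=.
by apply: eq_bigr => i _; rewrite mxE; case: (_ != _).
Qed.

(* kap and kap' colour F so that the Fourier transforms of the kap-classes are
   constant on kap'-classes. Both colourings have d+1 colours, so the inclusion of the
   Bose-Mesner algebra in the span of the matrices E below is an equality by dimension. *)
Section Dual.
Variables (d : nat) (kap kap' : F -> 'I_d.+1) (R : 'I_d.+1 -> {set F * F}).
Hypothesis RE : forall k x y, ((x, y) \in R k) = (kap (x - y) == k).
Hypotheses (kap0 : forall x, (kap x == ord0) = (x == 0))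
           (kap'0 : forall y, (kap' y == ord0) = (y == 0)).
Hypotheses (kapN : forall x, kap (- x) = kap x).
Hypotheses (kap_surj : forall k, exists x, kap x = k)
           (kap'_surj : forall e, exists y, kap' y = e).
Hypothesis dual : forall k y y', kap' y = kap' y' ->
  \sum_(x | kap x == k) psi (x * y) = \sum_(x | kap x == k) psi (x * y').

Let A := adjacency_mx R C.
Let E e := spectral_mx (fun y => (kap' y == e)%:R).
Let lam k y := \sum_(x | kap x == k) psi (x * y).

Lemma adjacency_spectral k : A k = spectral_mx (lam k).
Proof.
apply/matrixP => i j; rewrite spectral_mxE mxE RE.
under eq_bigr do rewrite mulr_suml.
rewrite exchange_big /=.
under eq_bigr => x _ do under eq_bigr => y _ do
  rewrite (mulrC x) -psiD -mulrDr.
under eq_bigr => x _ do rewrite sum_char addr_eq0 opprB.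
rewrite big_mkcond (bigD1 (ev j - ev i)) //= eqxx big1 ?addr0; last first.
  by move=> x /negPf ->; case: ifP.
(* Orthogonality leaves only [x = ev j - ev i], the opposite of the difference tested by [RE];
   [kapN] absorbs the sign. *)
by rewrite -opprB kapN; case: (_ == k); rewrite ?mulVf ?mulr0.
Qed.

Lemma spectral_class c : spectral_mx (fun y => c (kap' y)) = \sum_e c e *: E e.
Proof.
apply/matrixP => i j; rewrite summxE spectral_mxE.
under [RHS]eq_bigr => e _ do rewrite mxE spectral_mxE mulrCA mulr_sumr.
rewrite -mulr_sumr exchange_big; congr (_ * _); apply: eq_bigr => y _ /=.
rewrite (bigD1 (kap' y)) //= eqxx mul1r big1 ?addr0 // => e.
by rewrite eq_sym => /negPf ->; rewrite mul0r mulr0.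
Qed.

Lemma lam_class k : exists c, lam k =1 (fun y => c (kap' y)).
Proof.
have rep e : {y | kap' y == e} by apply: sigW; have [y <-] := kap'_surj e; exists y.
by exists (fun e => lam k (sval (rep e))) => y; apply: dual; rewrite (eqP (svalP (rep _))).
Qed.

Lemma sum_adjacencyE c x y :
  (\sum_k c k *: A k) (enum_rank x) (enum_rank y) = c (kap (x - y)).
Proof.
rewrite summxE (bigD1 (kap (x - y))) //= big1 => [|k].
  by rewrite !mxE !enum_rankK RE eqxx mulr1 addr0.
by rewrite !mxE !enum_rankK RE eq_sym => /negPf ->; rewrite mulr0.
Qed.

Lemma bose_mesner_tuple : bose_mesner R C = <<[tuple A k | k < d.+1]>>%VS.
Proof. by congr (<<_>>%VS); rewrite /codom /image_mem /= enumT. Qed.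

Lemma bose_mesner_adjP M : M \in bose_mesner R C -> exists c, M = \sum_k c k *: A k.
Proof.
rewrite bose_mesner_tuple => /coord_span ->.
exists (fun k => coord [tuple A k | k < d.+1] k M).
by apply: eq_bigr => k _; rewrite -tnth_nth tnth_mktuple.
Qed.

(** Identifies the Bose-Mesner algebra with the functions of the dual colour under pointwise
    product; closure under products and the list of idempotents are read off from this. *)
Lemma bose_mesnerP M :
  M \in bose_mesner R C <-> exists c, M = spectral_mx (fun y => c (kap' y)).
Proof.
(* The entry at [(x, 0)] of a combination is the coefficient of the colour of [x], and every colour
   occurs. *)
have freeA : free [tuple A k | k < d.+1].
  apply/freeP => c; under eq_bigr do rewrite -tnth_nth tnth_mktuple.
  move=> c0 k; have [x <-] := kap_surj k.
  by rewrite -[x]subr0 -sum_adjacencyE c0 mxE.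
have sub : (<<[tuple A k | k < d.+1]>> <= <<[tuple E k | k < d.+1]>>)%VS.
  apply/span_subvP => _ /tnthP[k ->]; rewrite tnth_mktuple adjacency_spectral.
  have [c /eq_spectral_mx ->] := lam_class k; rewrite (spectral_class c).
  apply: memv_suml => e _; apply/memvZ/memv_span.
  by apply/tnthP; exists e; rewrite tnth_mktuple.
have eqAE : (<<[tuple A k | k < d.+1]>> = <<[tuple E k | k < d.+1]>>)%VS.
  apply/eqP; rewrite eqEdim sub (eqP freeA) size_tuple.
  by rewrite (leq_trans (dim_span _)) // size_tuple.
rewrite bose_mesner_tuple eqAE; split=> [/coord_span ->|[c ->]].
  exists (fun e => coord [tuple E e | e < d.+1] e M).
  rewrite (spectral_class (fun e => coord _ e M)).
  by apply: eq_bigr => k _; rewrite -tnth_nth tnth_mktuple.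
rewrite (spectral_class c); apply: memv_suml => e _; apply/memvZ/memv_span.
by apply/tnthP; exists e; rewrite tnth_mktuple.
Qed.

Lemma dual_association_scheme : association_scheme R.
Proof.
split.
- split=> [k|i j ij|].
  + by have [x <-] := kap_surj k; apply/set0Pn; exists (x, 0); rewrite RE subr0.
  + apply/pred0P => -[x y] /=; rewrite !RE; apply/negP => /andP[/eqP -> /eqP e].
    by rewrite e eqxx in ij.
  + by apply/setP => -[x y]; rewrite inE; apply/bigcupP; exists (kap (x - y)); rewrite ?RE.
- by apply/setP => -[x y]; rewrite RE inE /= kap0 subr_eq0.
- by move=> i x y; rewrite !RE -opprB kapN.
move=> i j k.
have [ci hi] := lam_class i; have [cj hj] := lam_class j.
(* The eigenvalues of the product are again constant on dual classes, so it lies in the span of the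
   [A k]; its coefficients are the intersection numbers. *)
have [c hc] : exists c, A i *m A j = \sum_k c k *: A k.
  apply/bose_mesner_adjP/bose_mesnerP; exists (fun e => ci e * cj e).
  rewrite !adjacency_spectral spectral_mxM; apply: eq_spectral_mx => y.
  by rewrite hi hj.
have count x y : #|[set z | ((x, z) \in R i) && ((z, y) \in R j)]|%:R = c (kap (x - y)).
  rewrite -sum_adjacencyE -hc mxE -sum1dep_card natr_sum big_mkcond /=.
  rewrite (reindex _ (onW_bij _ (enum_val_bij F))) /=; apply: eq_bigr => z _.
  by rewrite !mxE !enum_rankK; do 2!case: (_ \in _); rewrite ?mulr0 ?mulr1.
(* The coefficient [c k] lives in [C]; the natural number it equals is obtained by counting at one
   pair [(x0, 0)] of colour [k]. *)
have [x0 hx0] := kap_surj k.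
exists #|[set z | ((x0, z) \in R i) && ((z, 0) \in R j)]| => x y.
rewrite RE => /eqP kxy; apply/eqP; rewrite -(eqr_nat C) !count kxy subr0 hx0.
exact: eqxx.
Qed.

Lemma dual_primitive_idempotents : primitive_idempotents R E.
Proof.
have cl (c c' : 'I_d.+1 -> C) : (forall y, c (kap' y) = c' (kap' y)) -> c =1 c'.
  by move=> h e; have [y <-] := kap'_surj e.
have idemP M : bm_idempotent R M ->
    exists2 c, M = spectral_mx (fun y => c (kap' y)) & forall e, c e * c e = c e.
  case=> /bose_mesnerP[c ->]; rewrite spectral_mxM => /spectral_mx_inj h.
  by exists c => //; apply: (cl (fun e => c e * c e)).
have Pidem c : (forall e, c e * c e = c e) ->
    bm_idempotent R (spectral_mx (fun y => c (kap' y))).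
  move=> h; split; first by apply/bose_mesnerP; exists c.
  by rewrite spectral_mxM; apply: eq_spectral_mx => y.
have Eidem e : bm_idempotent R (E e).
  by apply: (Pidem (fun e' => (e' == e)%:R)) => e'; rewrite -natrM mulnb andbb.
have E0 e : E e != 0.
  apply/eqP => /spectral_mx_eq0 h.
  by have [y ye] := kap'_surj e; move: (h y); rewrite ye eqxx => /eqP; rewrite oner_eq0.
split.
- apply/matrixP => i j; rewrite spectral_mxE mxE (bigD1 0) //= kap'0 eqxx.
  rewrite mul0r psi0 mulr1 big1 ?addr0 ?mulr1 // => y /negPf y0.
  by rewrite kap'0 y0 mul0r.
- move=> e e' /spectral_mx_inj h; have [y ye] := kap'_surj e.
  by move: (h y); rewrite ye eqxx; case: eqP => // _ /eqP; rewrite oner_eq0.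
- move=> M; split=> [[/idemP[c -> cc] M0 prim]|[i ->]].
    have [e ce] : exists e, c e != 0.
      case: (pickP (fun e => c e != 0)) => [e|c0]; first by exists e.
      by rewrite spectral_mx0 ?eqxx // in M0 => y; apply/eqP/negbFE/c0.
    have ce1 : c e = 1 by apply: (mulfI ce); rewrite cc mulr1.
    (* Splitting off the indicator of [e] leaves an idempotent orthogonal to the nonzero [E e];
       primitivity forces this remainder to vanish. *)
    exists e; pose c2 e' := c e' - (e' == e)%:R.
    have dec : spectral_mx (fun y => c (kap' y)) = E e + spectral_mx (fun y => c2 (kap' y)).
      by rewrite spectral_mxD; apply: eq_spectral_mx => y; rewrite addrC subrK.
    have c20 e' : (e' == e)%:R * c2 e' = 0.
      by rewrite /c2; case: eqP => [->|_]; rewrite ?mul0r // ce1 subrr mulr0.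
    case: (prim (E e) (spectral_mx (fun y => c2 (kap' y)))) => //.
    + apply: Pidem => e'; rewrite /c2; case: eqP => [->|_].
        by rewrite ce1 subrr mulr0.
      by rewrite subr0.
    + by rewrite spectral_mxM spectral_mx0.
    + by rewrite spectral_mxM spectral_mx0 // => y; rewrite mulrC.
    + by move=> e0; have := E0 e; rewrite e0 eqxx.
    + by rewrite dec => ->; rewrite addr0.
  split=> // E1 E2 /idemP[c1 -> cc1] /idemP[c2 -> cc2].
  rewrite spectral_mxM => /spectral_mx_eq0 h12 _.
  rewrite spectral_mxD => /spectral_mx_inj hD.
  have c12 := cl (fun e => c1 e * c2 e) (fun => 0) h12.
  have h := cl (fun e => (e == i)%:R) (fun e => c1 e + c2 e) hD.
  (* Off [i] the sum [c1 + c2] is 0, so [c1 = c1 * (c1 + c2) = 0] by idempotence and orthogonality,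
     and likewise [c2]. At [i] the product is 0, so one of the two vanishes everywhere. *)
  have ne e : e != i -> c1 e = 0 /\ c2 e = 0.
    move=> /negPf ei; have := h e; rewrite ei => s0.
    split; first by rewrite -cc1 -[LHS]addr0 -(c12 e) -mulrDr -s0 mulr0.
    by rewrite -cc2 -[LHS]add0r -(c12 e) -mulrDl -s0 mul0r.
  have /eqP := c12 i; rewrite mulf_eq0 => /orP[]/eqP z; [left|right];
    apply: spectral_mx0 => y; case: (eqVneq (kap' y) i) => [->//|/ne[]//].
Qed.

(** The rank of [E e] is its number of nonzero eigenvalues, that is, the size of the dual class
    [e]. *)
Lemma dual_pseudocyclic t :
  (forall e, e != ord0 -> #|[set y | kap' y == e]| = t) -> pseudocyclic R C.
Proof.
move=> ht; exists E; first exact: dual_primitive_idempotents.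
exists t => e e0; rewrite -(ht e e0) rank_spectral_mx; congr #|pred_of_set _|.
by apply/setP => y; rewrite !inE; case: (_ == e); rewrite ?oner_eq0 ?eqxx.
Qed.

End Dual.
End Fourier.

(** * A Frobenius-invariant additive character *)

(** A root of [1 + X + ... + X^(p-1)] has order dividing [p], and the order is not 1 because the
    value at 1 is [p], nonzero in [C]. *)
Lemma prime_unity_root_exists (C : numClosedFieldType) (p : nat) :
  prime p -> exists z : C, p.-primitive_root z.
Proof.
move=> p_pr.
have /closed_rootP[z] : size (\poly_(i < p) (1 : C)) != 1%N.
  rewrite size_poly_eq ?oner_eq0 //; by case: p p_pr => [|[|]].
rewrite /root horner_poly; under eq_bigr do rewrite mul1r.
move=> /eqP z0.
have zp : z ^+ p = 1 by apply/eqP; rewrite -subr_eq0 subrX1 z0 mulr0.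
have [m zm m_p] := prim_order_exists (prime_gt0 p_pr) zp.
exists z; have /primeP[_ /(_ m m_p)/orP[]/eqP e] := p_pr; last by rewrite -e.
move: zm z0; rewrite e => /prim_expr_order; rewrite expr1 => ->.
under eq_bigr do rewrite expr1n.
by rewrite sumr_const card_ord => /eqP; rewrite pnatr_eq0; case: (p) p_pr.
Qed.

(** * The trace to the prime field and the character it defines *)

Section Trace.
Variables (F : finFieldType) (p f : nat).
Hypotheses (p_pr : prime p) (cardF : #|F| = (p ^ f)%N).

Let pcharF : p \in [pchar F].
Proof. exact: card_finPcharP cardF p_pr. Qed.

(** The absolute trace to the prime field, with values kept in [F]. *)
Definition frob_trace (x : F) : F := \sum_(i < f) x ^+ (p ^ i)%N.

Lemma frobD x y n : (x + y : F) ^+ (p ^ n)%N = x ^+ (p ^ n)%N + y ^+ (p ^ n)%N.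
Proof.
elim: n => [|n IH]; first by rewrite !expr1.
by rewrite expnS mulnC !exprM IH -!(pFrobenius_autE pcharF) rmorphD.
Qed.

Lemma frob_traceD x y : frob_trace (x + y) = frob_trace x + frob_trace y.
Proof. by rewrite /frob_trace -big_split; apply: eq_bigr => i _; apply: frobD. Qed.

Lemma frob_trace_frob x : frob_trace (x ^+ p) = frob_trace x.
Proof.
have f_gt0 : (0 < f)%N.
  by case: (posnP f) (finNzRing_gt1 F) => // e; rewrite cardF e.
rewrite /frob_trace; case: (f) f_gt0 cardF => // n _ cF.
rewrite big_ord_recr big_ord_recl /= -exprM -expnS -cF expf_card expr1 addrC.
by congr (_ + _); apply: eq_bigr => i _; rewrite -exprM -expnS.
Qed.

Lemma frob_trace_fixed x : frob_trace x ^+ p = frob_trace x.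
Proof.
rewrite -[RHS]frob_trace_frob -(pFrobenius_autE pcharF) rmorph_sum.
by apply: eq_bigr => i _ /=; rewrite pFrobenius_autE -!exprM mulnC.
Qed.

(** The trace is a nonzero polynomial (its coefficient at [X] is 1) of degree at most [p^(f-1)], too
    small to vanish on all [p^f] elements. *)
Lemma frob_trace_neq0 : exists x, frob_trace x != 0.
Proof.
case: (pickP (fun x => frob_trace x != 0)) => [x|T0]; first by exists x.
have f_gt0 : (0 < f)%N.
  by case: (posnP f) (finNzRing_gt1 F) => // e; rewrite cardF e.
pose Q : {poly F} := \sum_(i < f) 'X^(p ^ i)%N.
have sQ : (size Q <= (p ^ f.-1).+1)%N.
  apply: (leq_trans (size_sum _ _ _)); apply/bigmax_leqP => i _.
  rewrite size_polyXn ltnS leq_exp2l ?prime_gt1 //.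
  by rewrite -ltnS prednK.
have Q0 : Q != 0.
  apply/eqP => /(congr1 (fun r : {poly F} => r`_1)); rewrite coef0 coef_sum.
  rewrite (bigD1 (Ordinal f_gt0)) //= big1 ?addr0 => [|i].
    by rewrite coefXn expn0 eqxx => /eqP; rewrite oner_eq0.
  rewrite -val_eqE /= coefXn => i0.
  by rewrite eq_sym -(expn0 p) eqn_exp2l ?prime_gt1 // (negbTE i0).
have := max_poly_roots Q0 _ (enum_uniq F).
rewrite -cardT cardF => /(_ _)/leq_trans/(_ sQ) lt.
suff : (p ^ f < (p ^ f.-1).+1)%N.
  by rewrite ltnS leq_exp2l ?prime_gt1 // -ltnS prednK // ltnn.
apply: lt; apply/allP => x _; rewrite /root horner_sum.
under eq_bigr do rewrite hornerXn.
by move/negbFE: (T0 x).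
Qed.

Lemma natr_eq_pchar a b : (a%:R == b%:R :> F) = (a == b %[mod p])%N.
Proof.
wlog le_ab : a b / (a <= b)%N => [IH|].
  by case/orP: (leq_total a b) => ab; [|rewrite eq_sym [RHS]eq_sym]; apply: IH.
by rewrite eq_sym [RHS]eq_sym eqn_mod_dvd // (dvdn_pcharf pcharF) natrB // subr_eq0.
Qed.

(** The [p] elements [n%:R] are already all the roots that [X^p - X] can have. *)
Lemma frob_fixedP (y : F) : y ^+ p = y -> exists n : 'I_p, (n : nat)%:R == y.
Proof.
move=> yp.
case: (pickP (fun n : 'I_p => (n : nat)%:R == y)) => [n|ny]; first by exists n.
pose s := y :: [seq (i : nat)%:R | i : 'I_p <- enum 'I_p].
have Q0 : ('X^p - 'X : {poly F}) != 0.
  rewrite -size_poly_gt0 size_polyDl ?size_polyXn // size_polyN size_polyX.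
  by rewrite ltnS prime_gt1.
have us : uniq s.
  rewrite /= map_inj_uniq ?enum_uniq ?andbT.
    by apply/mapP => -[i _ e]; have := ny i; rewrite e eqxx.
  by move=> i j /= /eqP; rewrite natr_eq_pchar !modn_small // => /eqP/val_inj.
have := max_poly_roots Q0 _ us.
rewrite /= size_map -cardE card_ord size_polyDl;
  rewrite ?size_polyXn ?size_polyN ?size_polyX ?ltnS ?prime_gt1 //.
rewrite ltnn => abs; suff : false by []; apply: abs.
rewrite /root !hornerE yp subrr eqxx /=; apply/allP => _ /mapP[i _ ->].
by rewrite /root !hornerE -(pFrobenius_autE pcharF) rmorph_nat subrr.
Qed.

(** The character is [z] raised to the trace, the trace being lifted to an integer below [p] and [z]
    a primitive [p]-th root of unity. *)
Lemma frobenius_char_exists (C : numClosedFieldType) :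
  exists psi : F -> C,
    [/\ psi 0 = 1,
        forall x y, psi (x + y) = psi x * psi y,
        forall x, psi (x ^+ p) = psi x
      & exists x, psi x != 1].
Proof.
have [z zp] := prime_unity_root_exists C p_pr.
have lgE x : {n : 'I_p | (n : nat)%:R == frob_trace x}.
  by apply: sigW; apply/frob_fixedP/frob_trace_fixed.
exists (fun x => z ^+ sval (lgE x)); split=> [|x y|x|].
- apply/eqP; rewrite -(prim_order_dvd zp) (dvdn_pcharf pcharF).
  by rewrite (eqP (svalP (lgE _))) /frob_trace big1 // => i _;
  rewrite expr0n expn_eq0; case: (p) p_pr.
- rewrite -exprD; apply/eqP; rewrite (eq_prim_root_expr zp) -natr_eq_pchar natrD.
  by rewrite !(eqP (svalP (lgE _))) frob_traceD.
- apply/eqP; rewrite (eq_prim_root_expr zp) -natr_eq_pchar.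
  by rewrite !(eqP (svalP (lgE _))) frob_trace_frob.
- have [x Tx] := frob_trace_neq0; exists x.
  by rewrite -(prim_order_dvd zp) (dvdn_pcharf pcharF) (eqP (svalP (lgE _))).
Qed.
End Trace.

Local Close Scope ring_scope.

(** * Gauss periods in the index 2 case *)

(** Each further [r]-th power multiplies [u^(r^k) - 1] by a geometric sum of [r] terms congruent to
    1 modulo [r], hence by a multiple of [r]. *)
Lemma dvdn_pred_exp_pexp r u k :
  0 < u -> r %| u.-1 -> r ^ k.+1 %| (u ^ (r ^ k)).-1.
Proof.
move=> u0 ru; have u1 : u = 1 %[mod r] by apply/eqP; rewrite eqn_mod_dvd // subn1.
elim: k => [|k IH]; first by rewrite !expn1.
rewrite expnSr [in X in _ %| X]expnSr expnM predn_exp dvdn_mul //.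
have uX j : u ^ j = 1 %[mod r] by rewrite -modnXm u1 modnXm exp1n.
rewrite /dvdn -modn_summ; under eq_bigr => i _ do rewrite -expnM uX.
by rewrite modn_summ sum_nat_const card_ord muln1 modnn.
Qed.

(** The multiplier of [N] stands for [a %/ N - i %/ N], with [L.-1] in place of -1; it lifts a
    congruence modulo [N] to one modulo [L]. *)
Lemma modn_lift N L a i : 0 < L -> a = i %[mod N] ->
  i + (a %/ N + i %/ N * L.-1) * N = i %/ N * N * L + a.
Proof.
move=> L0 ai; rewrite {1}(divn_eq i N) [in RHS](divn_eq a N) ai.
have := prednK L0; move: (L.-1) => L' <-; lia.
Qed.

Section Index2.
Variables (N p : nat).
Hypotheses (N_gt1 : 1 < N) (pN : coprime p N).

Lemma natr_Zp_eq a b : (a%:R = b%:R :> 'Z_N)%R -> a = b %[mod N].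
Proof. by move=> /(congr1 val) /=; rewrite !val_Zp_nat. Qed.

Lemma val_unit_of_nat u : coprime u N ->
  val (insubd (1%g : {unit 'Z_N}) u%:R%R) = u%:R%R.
Proof. by move=> uN; rewrite val_insubd unitZpE // coprime_sym uN. Qed.

Lemma ord_mod_exp : p ^ ord_mod N p = 1 %[mod N].
Proof.
apply: natr_Zp_eq; rewrite natrX -(val_unit_of_nat pN) -FinRing.val_unitX.
by rewrite expg_order.
Qed.

(** The powers of [p] form a subgroup of index 2 in the units; it is normal with quotient of order
    2, so it contains every square. *)
Lemma square_power u : ord_mod N p = totient N %/ 2 -> 2 %| totient N ->
  coprime u N -> exists j, p ^ j = u ^ 2 %[mod N].
Proof.
move=> op e2 uN; pose x := insubd (1%g : {unit 'Z_N}) p%:R%R.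
pose v := insubd (1%g : {unit 'Z_N}) u%:R%R.
have HG : <[x]>%g \subset units_Zp N by apply: subsetT.
have ox : #[x]%g = totient N %/ 2 by [].
have idx : #|units_Zp N : <[x]>|%g = 2.
  rewrite -divgS // card_units_Zp ?(ltnW N_gt1) // -orderE ox.
  by rewrite -{1}(divnK e2) mulKn // divn_gt0 // dvdn_leq // totient_gt0 ltnW.
have /andP[_ nHG] := index2_normal HG idx.
have vN : v \in 'N(<[x]>)%g by apply: (subsetP nHG); rewrite inE.
have : (v ^+ 2)%g \in <[x]>%g.
  apply: coset_idr; rewrite ?groupX // morphX //.
  rewrite -idx -card_quotient // expg_cardG //.
  by apply: mem_quotient; rewrite inE.
case/cycleP=> j /(congr1 val); rewrite !FinRing.val_unitX /= !val_unit_of_nat //.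
by rewrite -!natrX => /natr_Zp_eq e; exists j.
Qed.

End Index2.

(** * Turning a family of classes into a colouring of the field *)

Section Colouring.
Variables (F : finFieldType) (n : nat).

Definition colour_class (D : nat -> {set F}) (k : 'I_n.+1) (x : F) :=
  if k == ord0 then (x == 0)%R else x \in D k.-1.

Lemma colouring_exists (D : nat -> {set F}) :
    (forall k, 0%R \notin D k) ->
    (forall x, x != 0%R -> exists2 k, k < n & x \in D k) ->
    (forall x k k', k < n -> k' < n -> x \in D k -> x \in D k' -> k = k') ->
  exists kap : F -> 'I_n.+1, forall x k, (kap x == k) = colour_class D k x.
Proof.
move=> D0 Dex Duniq.
have ex x : {k | colour_class D k x}.
  apply: sigW; case: (eqVneq x 0%R) => [->|/Dex[k kd xk]].
    by exists ord0; rewrite /colour_class !eqxx.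
  by exists (lift ord0 (Ordinal kd)); rewrite /colour_class -val_eqE.
exists (fun x => sval (ex x)) => x k; case: (ex x) => k' /= hk'.
apply/eqP/idP => [<- //|]; move: hk'; rewrite /colour_class.
case: (k' =P ord0) => [->|k'0]; case: (k =P ord0) => [->|k0] //.
- by move/eqP=> ->; rewrite (negbTE (D0 _)).
- by move=> h /eqP x0; rewrite x0 (negbTE (D0 _)) in h.
have k'p : 0 < k' by rewrite lt0n; apply/eqP => e; apply: k'0; apply: val_inj.
have kp : 0 < k by rewrite lt0n; apply/eqP => e; apply: k0; apply: val_inj.
move=> h' h; apply: val_inj; rewrite /= -(prednK kp) -(prednK k'p); congr _.+1.
by apply: Duniq h' h; rewrite -ltnS prednK ?ltn_ord.
Qed.

End Colouring.

(** * Arithmetic of the class indices modulo [N] *)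

Section Periods.
Variables (p1 p2 m p : nat).
Hypotheses (p1_pr : prime p1) (p2_pr : prime p2) (p12 : p1 != p2).
Hypothesis m_gt0 : 0 < m.
Local Notation P := (p1 ^ (m - 1)).
Local Notation d := (p1 * p2).
Local Notation N := (p1 ^ m * p2).

Lemma NE : N = P * d.
Proof. by rewrite mulnA -expnSr -subSn // subn1. Qed.

Lemma P_gt0 : 0 < P. Proof. by rewrite expn_gt0 prime_gt0. Qed.
Lemma d_gt0 : 0 < d. Proof. by rewrite muln_gt0 !prime_gt0. Qed.
Lemma N_gt1 : 1 < N.
Proof.
rewrite NE (leq_trans (prime_gt1 p2_pr)) // mulnA leq_pmull //.
by rewrite muln_gt0 P_gt0 prime_gt0.
Qed.

Lemma coprime_p1p2 : coprime p1 p2.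
Proof. by rewrite prime_coprime // dvdn_prime2. Qed.

Lemma coprime_Pp2 : coprime P p2.
Proof. by rewrite coprimeXl // coprime_p1p2. Qed.

Lemma mulp2_mod_inj i i' : i < P -> i' < P -> i * p2 = i' * p2 %[mod P] -> i = i'.
Proof.
wlog le : i i' / i <= i' => [IH|] iP i'P.
  by case/orP: (leq_total i i') => h e; [|symmetry]; apply: IH.
move=> /esym/eqP; rewrite eqn_mod_dvd ?leq_mul2r ?le ?orbT // -mulnBl.
rewrite Gauss_dvdl ?coprime_Pp2 // => h; apply/eqP; rewrite eqn_leq le /= -subn_eq0.
apply: contraTT h; rewrite -lt0n => h; rewrite gtnNdvd //.
by rewrite (leq_ltn_trans (leq_subr _ _)).
Qed.

Lemma mulP_mod_inj k k' : k < d -> k' < d -> k * P = k' * P %[mod N] -> k = k'.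
Proof.
move=> kd k'd; rewrite NE !(mulnC _ P) -!muln_modr => /eqP.
by rewrite eqn_pmul2l ?P_gt0 // !modn_small // => /eqP.
Qed.

Lemma mod_N_P a b : a = b %[mod N] -> a = b %[mod P].
Proof.
have PN : P %| N by rewrite NE dvdn_mulr.
by move=> ab; rewrite -(modn_dvdm a PN) ab modn_dvdm.
Qed.

Lemma D_index_inj i k i' k' : i < P -> i' < P -> k < d -> k' < d ->
  i * p2 + k * P = i' * p2 + k' * P %[mod N] -> i = i' /\ k = k'.
Proof.
move=> iP i'P kd k'd e.
have ii : i = i'.
  by apply: mulp2_mod_inj => //; move: (mod_N_P e); rewrite !(addnC _ (_ * P)) !modnMDl.
split=> //; apply: mulP_mod_inj => //; apply/eqP.
by rewrite -(eqn_modDl (i * p2)) {2}ii; apply/eqP.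
Qed.

Lemma dual_D_index_inj a i e i' e' : i < P -> i' < P -> e < d -> e' < d ->
  a + i * p2 = e * P %[mod N] -> a + i' * p2 = e' * P %[mod N] -> e = e'.
Proof.
move=> iP i'P ed e'd h h'.
have ii : i = i'.
  apply: mulp2_mod_inj => //; apply/eqP; rewrite -(eqn_modDl a).
  by rewrite (mod_N_P h) (mod_N_P h') !modnMl.
by apply: mulP_mod_inj => //; rewrite -h -h' ii.
Qed.

Lemma dual_D_index_exists a : exists i e,
  [/\ i < P, e < d & a + i * p2 = e * P %[mod N]].
Proof.
(* This is [-a / p2] modulo [P]: [P.-1] stands for -1, and the power of [p2] is its inverse by
   Euler's theorem. *)
pose i := (a * P.-1 * p2 ^ (totient P).-1) %% P.
have /dvdnP[e0 he0] : P %| a + i * p2.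
  rewrite /dvdn -modnDmr /i modnMml -mulnA -expnSr prednK ?totient_gt0 ?P_gt0 //.
  rewrite -modnMmr Euler_exp_totient 1?coprime_sym ?coprime_Pp2 // modnMmr muln1 modnDmr.
  by rewrite -mulnS prednK ?P_gt0 // modnMl.
exists i, (e0 %% d); split; rewrite ?ltn_mod ?P_gt0 ?d_gt0 // he0.
by rewrite NE !(mulnC _ P) -!muln_modr modn_mod.
Qed.

Lemma D_index_exists a : exists i k,
  [/\ i < P, k < d & a = i * p2 + k * P %[mod N]].
Proof.
(* Applied to [-a], coded as [a * N.-1], the dual statement gives [a = i * p2 - e * P] modulo [N],
   whence [k = -e] modulo [d]. *)
have [i [e [iP ed h]]] := dual_D_index_exists (a * N.-1).
exists i, ((e * d.-1) %% d); split; rewrite ?ltn_mod ?d_gt0 //.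
have e1 : (e * d.-1) %% d * P = e * d.-1 * P %[mod N].
  by rewrite NE !(mulnC _ P) -!muln_modr modn_mod.
rewrite -modnDmr e1 modnDmr.
have N0 := ltnW N_gt1.
have aN : a * N.-1 + a = a * N by rewrite -mulnSr prednK.
have eN : e * d.-1 * P + e * P = e * N by rewrite -mulnDl -mulnSr prednK ?d_gt0 // NE; lia.
apply/eqP; rewrite -(eqn_modDl (a * N.-1)) aN modnMl addnA.
rewrite -modnDml h modnDml addnC eN modnMl //.
Qed.

Hypotheses (p1_odd : odd p1) (p2_odd : odd p2).
Hypotheses (pN : coprime p N) (op : ord_mod N p = totient N %/ 2).

Lemma even_totient : 2 %| totient N.
Proof.
rewrite totient_coprime ?coprimeXl ?coprime_p1p2 //.
apply: dvdn_mull; rewrite totient_prime // dvdn2.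
by case: (p2) p2_odd.
Qed.

(* The units congruent to 1 modulo p1 p2 form a group of odd order p1^(m-1), so
   they are squares, and the index-2 subgroup generated by p contains all squares. *)
Lemma unit1_power u : 0 < u -> d %| u.-1 -> exists j, p ^ j = u %[mod N].
Proof.
move=> u0 du.
have uN : coprime u N.
  have h r : r %| u.-1 -> coprime u r.
    move=> ru; rewrite -(prednK u0); case/dvdnP: ru => k ->.
    by rewrite -addn1 /coprime gcdnC gcdnMDl gcdn1.
  rewrite coprimeMr coprimeXr ?h //; apply: dvdn_trans du.
    exact: dvdn_mull.
  exact: dvdn_mulr.
have uP : u ^ P = 1 %[mod N].
  apply/eqP; rewrite chinese_remainder ?coprimeXl ?coprime_p1p2 //.
  rewrite !eqn_mod_dvd ?expn_gt0 ?u0 // !subn1; apply/andP; split.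
    rewrite -{1}[m](prednK m_gt0) -subn1; apply: dvdn_pred_exp_pexp => //.
    by apply: dvdn_trans du; apply: dvdn_mulr.
  by rewrite predn_exp dvdn_mulr // (dvdn_trans _ du) // dvdn_mull.
(* As [P] is odd and [u^P = 1] modulo [N], [u] is the square of [u^((P+1)/2)]. *)
have [j hj] := square_power N_gt1 pN op even_totient (coprimeXl P.+1./2 uN).
exists j; rewrite hj -expnM muln2 even_halfK ?expnS; last by rewrite /= oddX p1_odd orbT.
by rewrite mulnC -modnMml uP modnMml mul1n.
Qed.

(** * Sums of Frobenius-invariant functions along steps of [p2] *)

Section Invariant.
Variables (T : zmodType) (S : nat -> T).
Hypothesis S_mod : forall a b, a = b %[mod N] -> S a = S b.
Hypothesis S_frob : forall a, S (p * a) = S a.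

Lemma S_pow j a : S (p ^ j * a) = S a.
Proof. by elim: j => [|j IH]; rewrite ?mul1n // expnS -mulnA S_frob. Qed.

Lemma S_shift b : ~~ (P %| b) -> S (b + P * p2) = S b.
Proof.
move=> Pb; have b0 : 0 < b by case: b Pb; rewrite ?dvdn0.
have [b' cb' bE] := pfactor_coprime p1_pr b0; set v := logn p1 b in bE.
have vm : v < m - 1.
  by rewrite ltnNge; apply: contra Pb => vm; rewrite bE dvdn_mull // dvdn_exp2l.
(* The inverse of [b'] modulo [p1], by Fermat. *)
pose w := b' ^ (p1.-1).-1.
have wb' : w * b' = 1 %[mod p1].
  rewrite mulnC -expnS prednK; last by case: (p1) p1_pr p1_odd => [|[|[|]]].
  by rewrite -totient_prime // Euler_exp_totient // coprime_sym.
(* Since [v < m - 1], [u] is 1 modulo [p1 * p2]; and [u * b = b + P * p2 * (w * b')], which is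
   [b + P * p2] modulo [N = P * p2 * p1]. *)
pose u := (p2 * p1 ^ (m - 1 - v) * w).+1.
have [] := @unit1_power u => //.
  rewrite /u /= dvdn_mulr // mulnC dvdn_mul //.
  by rewrite -[X in X %| _]expn1 dvdn_exp2l // subn_gt0.
move=> j hj; rewrite -[RHS](S_pow j); apply: S_mod.
rewrite -[RHS]modnMml hj modnMml /u mulSn; apply/eqP; rewrite eqn_modDl.
have -> : p2 * p1 ^ (m - 1 - v) * w * b = P * p2 * (w * b').
  rewrite [in LHS]bE -{2}(subnK (ltnW vm)) expnD; lia.
have -> : N = P * p2 * p1 by rewrite NE; lia.
by rewrite -{1}[P * p2]muln1 -!muln_modr wb'.
Qed.

Definition period_sum b : T := (\sum_(i < P) S (b + i * p2))%R.

Lemma period_sum_mod a b : a = b %[mod N] -> period_sum a = period_sum b.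
Proof.
move=> ab; apply: eq_bigr => i _; apply: S_mod.
by apply/eqP; rewrite eqn_modDr; apply/eqP.
Qed.

(** The shift by [p2] drops the term at [b] and adds the one at [b + P * p2], which are equal. *)
Lemma period_sum_step b : ~~ (P %| b) -> period_sum (b + p2) = period_sum b.
Proof.
move=> /S_shift; rewrite /period_sum; move: P_gt0; case: (P) => // k _ e.
rewrite big_ord_recr [RHS]big_ord_recl /= mul0n addn0 addrC; congr (_ + _)%R.
  by rewrite -e mulSn addnA.
by apply: eq_bigr => i _; rewrite /= /bump /= mulSn addnA.
Qed.

Lemma period_sum_class b i e :
  i < P -> b + i * p2 = e * P %[mod N] -> period_sum b = period_sum (e * P).
Proof.
move=> iP bi; rewrite -(period_sum_mod bi).
have Pbi : P %| b + i * p2.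
  have PN : P %| N by rewrite NE dvdn_mulr.
  by rewrite /dvdn -(modn_dvdm _ PN) bi modn_dvdm // modnMl.
have : forall j, j <= i -> period_sum (b + j * p2) = period_sum b; last first.
  by move/(_ i (leqnn _)).
elim=> [|j IH] ji; first by rewrite mul0n addn0.
rewrite mulSn (addnC p2) addnA period_sum_step ?IH ?(ltnW ji) //.
(* No [j < i] reaches a multiple of [P]: otherwise [P] would divide [i - j], which lies strictly
   between 0 and [P]. *)
apply/negP => Pj; have : P %| (i - j) * p2.
  by rewrite mulnBl -(subnDl b (i * p2)) dvdn_sub.
rewrite Gauss_dvdl ?coprime_Pp2 // gtnNdvd ?subn_gt0 //.
by rewrite (leq_ltn_trans (leq_subr _ _)).
Qed.

End Invariant.

(** * Cyclotomic classes, their unions and the dual classes *)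

Section Cyclotomic.
Variables (F : finFieldType) (g : {unit F}).
Hypotheses (gen_g : generator [set: {unit F}] g) (NF : N %| #|F|.-1).
Let gamma : F := val g.
Local Notation CC := (cyclotomic_class g N).
Local Notation DD := (D_class g p1 p2 m).

Lemma val_expg a : val (g ^+ a)%g = (gamma ^+ a)%R.
Proof. exact: FinRing.val_unitX. Qed.

Lemma gamma_neq0 a : (gamma ^+ a != 0)%R.
Proof. by rewrite -val_expg -unitfE (valP (g ^+ a)%g). Qed.

Lemma gamma_log x : (x != 0)%R -> exists a, x = (gamma ^+ a)%R.
Proof.
rewrite -unitfE => ux; have : FinRing.unit F ux \in <[g]>%g.
  by rewrite -(eqP gen_g) inE.
by case/cycleP=> a /(congr1 val) /= ->; exists a; rewrite val_expg.
Qed.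

Lemma gamma_eq a b : (gamma ^+ a == gamma ^+ b)%R = (a == b %[mod #|F|.-1]).
Proof.
rewrite -!val_expg (inj_eq val_inj) eq_expg_mod_order orderE -(eqP gen_g).
by rewrite card_finField_unit.
Qed.

Lemma mod_F_N a b : a = b %[mod #|F|.-1] -> a = b %[mod N].
Proof. by move=> ab; rewrite -(modn_dvdm a NF) ab modn_dvdm. Qed.

Lemma cyclotomic_classP x i :
  reflect (exists t, x = gamma ^+ (i + t * N))%R (x \in CC i).
Proof.
apply: (iffP imsetP) => [[u]|[t ->]].
  case/lcosetP=> _ /cycleP[t ->] -> ->; exists t.
  by rewrite -expgM -expgD val_expg mulnC.
exists (g ^+ (i + t * N))%g; last by rewrite val_expg.
by apply/lcosetP; exists ((g ^+ N) ^+ t)%g; rewrite ?mem_cycle // -expgM -expgD mulnC.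
Qed.

Lemma mem_cyclotomic_class a i : (gamma ^+ a \in CC i)%R = (a == i %[mod N]).
Proof.
apply/cyclotomic_classP/eqP => [[t /eqP]|ai].
  by rewrite gamma_eq => /eqP/mod_F_N ->; rewrite addnC modnMDl.
set L := #|F|.-1.
have L0 : 0 < L by rewrite -ltnS prednK ?finNzRing_gt1 // ltnW ?finNzRing_gt1.
exists (a %/ N + (i %/ N) * L.-1); apply/eqP; rewrite gamma_eq.
by rewrite modn_lift // modnMDl.
Qed.

Lemma cyclotomic_class0 i : 0%R \notin CC i.
Proof. by apply/cyclotomic_classP => -[t /eqP]; rewrite eq_sym (negbTE (gamma_neq0 _)). Qed.

Lemma mem_D_class a k :
  reflect (exists2 i, i < P & a = i * p2 + k * P %[mod N]) (gamma ^+ a \in DD k)%R.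
Proof.
apply: (iffP bigcupP) => [[i _]|[i iP h]].
  by rewrite mem_cyclotomic_class => /eqP h; exists (i : nat).
by exists (Ordinal iP) => //; rewrite mem_cyclotomic_class; apply/eqP.
Qed.

Lemma D_class0 k : 0%R \notin DD k.
Proof. by apply/bigcupP => -[i _]; rewrite (negbTE (cyclotomic_class0 _)). Qed.

(** Writing -1 as [gamma^h], [N] divides [2 * h]; since [N] is odd it divides [h], so -1 lies in
    [C_0]. *)
Lemma D_class_opp k x : x \in DD k -> (- x)%R \in DD k.
Proof.
case: (eqVneq x 0%R) => [->|x0]; first by rewrite oppr0.
have [a ->] := gamma_log x0.
have m1 : (-1 != 0 :> F)%R by rewrite oppr_eq0 oner_eq0.
have [h hh] := gamma_log m1.
have Nh : N %| h.
  have : N %| h * 2.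
    apply: (dvdn_trans NF); have : (gamma ^+ (h * 2) == gamma ^+ 0)%R.
      by rewrite exprM -hh sqrrN expr1n.
    by rewrite gamma_eq mod0n.
  by rewrite Gauss_dvdl // coprimen2 oddM oddX p1_odd p2_odd orbT.
case/mem_D_class=> i iP e; rewrite -mulN1r hh -exprD; apply/mem_D_class.
by exists i => //; rewrite -modnDml (eqP Nh) add0n.
Qed.

(** The inverted class [D_0], translated by [gamma^(e * P)]; in this form its cardinality is visibly
    that of [D_0]. *)
Definition dual_D_class e : {set F} :=
  [set x | (x != 0) && (gamma ^+ (e * P) / x \in DD 0)]%R.

Lemma mem_dual_D_class a e :
  reflect (exists2 i, i < P & a + i * p2 = e * P %[mod N])
          (gamma ^+ a \in dual_D_class e)%R.
Proof.
set L := #|F|.-1.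
have L0 : 0 < L by rewrite -ltnS prednK ?finNzRing_gt1 // ltnW ?finNzRing_gt1.
have aL : a * L.-1 + a = a * L by rewrite -mulnSr prednK.
have aL0 : (a * L) %% N = 0 by apply/eqP; rewrite -/(dvdn _ _) dvdn_mull.
rewrite inE gamma_neq0 /=.
(* As [gamma^L = 1], the exponent [a * L.-1] serves as [-a]. *)
have -> : (gamma ^+ (e * P) / gamma ^+ a = gamma ^+ (e * P + a * L.-1))%R.
  apply: (mulIf (gamma_neq0 a)); rewrite divfK ?gamma_neq0 // -exprD -addnA aL.
  by apply/eqP; rewrite gamma_eq addnC modnMDl.
have eqv i : (e * P + a * L.-1 == i * p2 + 0 * P %[mod N]) = (a + i * p2 == e * P %[mod N]).
  rewrite mul0n addn0 -(eqn_modDr a) -addnA aL -modnDmr aL0 addn0.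
  by rewrite eq_sym (addnC a).
by apply: (iffP (mem_D_class _ _)) => -[i iP /eqP h]; exists i => //; apply/eqP;
  rewrite ?eqv // -eqv.
Qed.

Lemma card_dual_D_class e : #|dual_D_class e| = #|DD 0|.
Proof.
have -> : dual_D_class e = [set (gamma ^+ (e * P) / x)%R | x in DD 0].
  apply/setP => y; apply/idP/imsetP => [|[x xD ->]].
    rewrite inE => /andP[y0 yD]; exists (gamma ^+ (e * P) / y)%R => //.
    by rewrite invf_div mulrCA divff ?mulr1 // gamma_neq0.
  have x0 : x != 0%R by apply: contraTneq xD => ->; apply: D_class0.
  rewrite inE mulf_neq0 ?gamma_neq0 ?invr_neq0 //=.
  by rewrite invf_div mulrCA divff ?mulr1 // gamma_neq0.
by rewrite card_imset // => x y /(mulfI (gamma_neq0 _))/invr_inj.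
Qed.

(** * Gauss periods and character sums over the classes *)

Section PeriodSums.
Variables (C : numClosedFieldType) (psi : F -> C).
Hypothesis p_char : p \in [pchar F]%R.
Hypothesis psi_frob : forall x, psi (x ^+ p)%R = psi x.

(** Summing over the subgroup [C_0] of units makes shifts of the index into group translations. *)
Definition gauss_period a : C := (\sum_(u in <[g ^+ N]>%g) psi (val (g ^+ a * u)%g))%R.

Lemma sum_cyclotomic_class i b :
  (\sum_(x in CC i) psi (x * gamma ^+ b) = gauss_period (b + i))%R.
Proof.
rewrite big_imset /=; last by move=> u v _ _; apply: val_inj.
rewrite (reindex_inj (mulgI (g ^+ i)%g)) /=; apply: eq_big => u.
  by rewrite mem_lcoset mulKg.
move=> _; rewrite expgD mulrC -val_expg; congr psi.
by rewrite -mulgA.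
Qed.

Lemma gauss_period_mod a b : a = b %[mod N] -> gauss_period a = gauss_period b.
Proof.
have step a' t : gauss_period (t * N + a') = gauss_period a'.
  rewrite /gauss_period [RHS](reindex_inj (mulgI (g ^+ (t * N))%g)) /=.
  have gt : (g ^+ (t * N))%g \in <[g ^+ N]>%g by rewrite mulnC expgM mem_cycle.
  apply: eq_big => u; first by rewrite groupMl.
  by rewrite addnC expgD /= mulrA.
by move=> ab; rewrite (divn_eq a N) (divn_eq b N) !step ab.
Qed.

(** Frobenius is injective and maps [C_0] into itself, so it permutes [C_0]; [psi] is invariant
    under it. *)
Lemma gauss_period_frob a : gauss_period (p * a) = gauss_period a.
Proof.
have injp : injective (fun u : {unit F} => (u ^+ p)%g).
  move=> u v /(congr1 val); rewrite !FinRing.val_unitX -!(pFrobenius_autE p_char).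
  by move/fmorph_inj/val_inj.
have HE : <[g ^+ N]>%g = [set (u ^+ p)%g | u in <[g ^+ N]>%g] :> {set _}.
  apply/esym/eqP; rewrite eqEcard card_imset ?leqnn ?andbT //.
  by apply/subsetP => _ /imsetP[u uH ->]; rewrite groupX.
rewrite /gauss_period [in LHS]HE big_imset /=; last by move=> u v _ _; apply: injp.
by apply: eq_bigr => u _; rewrite -[RHS]psi_frob exprMn -!FinRing.val_unitX -expgM mulnC.
Qed.

Lemma sum_D_class k b :
  (\sum_(x in DD k) psi (x * gamma ^+ b) = period_sum gauss_period (b + k * P))%R.
Proof.
rewrite partition_disjoint_bigcup /=; last first.
  move=> i j ij; apply/pred0P => x /=; apply/negP => /andP[].
  case/cyclotomic_classP=> t ->; rewrite mem_cyclotomic_class addnC modnMDl.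
  rewrite eqn_modDr => /eqP/mod_N_P/mulp2_mod_inj e.
  by move/negP: ij; apply; apply/eqP/val_inj/e.
by apply: eq_bigr => i _; rewrite sum_cyclotomic_class addnAC -addnA.
Qed.

Lemma sum_D_class_dual k e y y' : y \in dual_D_class e -> y' \in dual_D_class e ->
  (\sum_(x in DD k) psi (x * y) = \sum_(x in DD k) psi (x * y'))%R.
Proof.
(* Adding [k * P] to the exponent [b] of [z] keeps the same [i] and turns the endpoint [e * P] into
   [(e + k) * P]. *)
have main z : z \in dual_D_class e ->
    (\sum_(x in DD k) psi (x * z) = period_sum gauss_period ((e + k) * P))%R.
  move=> zD; have z0 : z != 0%R by move: zD; rewrite inE => /andP[].
  have [b zb] := gamma_log z0; move: zD; rewrite zb => /mem_dual_D_class[i iP h].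
  rewrite sum_D_class; apply: (period_sum_class gauss_period_mod gauss_period_frob iP).
  by apply/eqP; rewrite addnAC mulnDl eqn_modDr; apply/eqP.
by move=> /main -> /main ->.
Qed.

End PeriodSums.
End Cyclotomic.
End Periods.

(** * The classes [D_k] and their duals as a pair of dual colourings *)

Theorem theorem3p1 (C : numClosedFieldType) (p1 p2 m N p f q : nat)
    (F : finFieldType) (g : {unit F})
    (hp1 : prime p1) (hp2 : prime p2)
    (hmod4 : (p1 %% 4 = 1 /\ p2 %% 4 = 3) \/ (p1 %% 4 = 3 /\ p2 %% 4 = 1))
    (hm : 1 <= m) (hN : N = p1 ^ m * p2)
    (hp : prime p) (hpN : coprime p N)
    (hord1 : ord_mod (p1 ^ m) p = totient (p1 ^ m))
    (hord2 : ord_mod p2 p = totient p2)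
    (hf : f = ord_mod N p) (hfN : f = totient N %/ 2)
    (hq : q = p ^ f) (hF : #|F| = q)
    (hg : generator [set: {unit F}] g) :
  association_scheme (fusion_rel g p1 p2 m) /\
  pseudocyclic (fusion_rel g p1 p2 m) C.
Proof.
have p12 : p1 != p2 by apply/eqP => e; move: hmod4; rewrite e => -[][->].
have odd4 r : r %% 4 = 1 \/ r %% 4 = 3 -> odd r.
  by rewrite {3}(divn_eq r 4) oddD oddM andbF => -[] ->.
have p1_odd : odd p1 by apply: odd4; case: hmod4 => -[]; auto.
have p2_odd : odd p2 by apply: odd4; case: hmod4 => -[]; auto.
have op : ord_mod N p = totient N %/ 2 by rewrite -hf.
have N1 : 1 < N by rewrite hN; apply: N_gt1.
have NF : N %| #|F|.-1.
  rewrite hF hq -subn1 -eqn_mod_dvd ?expn_gt0 ?prime_gt0 // hf; apply/eqP.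
  exact: ord_mod_exp.
rewrite hq in hF; subst N.
have p_char : p \in [pchar F]%R := card_finPcharP hF hp.
have [psi [psi0 psiD psi_frob psi_nt]] := frobenius_char_exists hp hF C.
have D0 := D_class0 p1 p2 m g.
have dual0 e : 0%R \notin dual_D_class p1 p2 m g e by rewrite inE eqxx.
have [kap kapE] : exists kap : F -> 'I_(p1 * p2).+1,
    forall x k, (kap x == k) = colour_class (D_class g p1 p2 m) k x.
  apply: colouring_exists => // [x x0|x k k' kd k'd].
    have [a ->] := gamma_log hg x0.
    have [i [k [iP kd h]]] := D_index_exists hp1 hp2 p12 hm a.
    by exists k => //; apply/(mem_D_class hg NF); exists i.
  case: (eqVneq x 0%R) => [->|x0]; first by rewrite (negbTE (D0 _)).
  have [a ->] := gamma_log hg x0.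
  case/(mem_D_class hg NF)=> i iP hi /(mem_D_class hg NF)[i' i'P hi'].
  have ii : i * p2 + k * p1 ^ (m - 1) = i' * p2 + k' * p1 ^ (m - 1) %[mod p1 ^ m * p2].
    by rewrite -hi -hi'.
  by have [] := D_index_inj hp1 hp2 p12 hm iP i'P kd k'd ii.
have [kap' kap'E] : exists kap : F -> 'I_(p1 * p2).+1,
    forall x k, (kap x == k) = colour_class (dual_D_class p1 p2 m g) k x.
  apply: colouring_exists => // [x x0|x k k' kd k'd].
    have [a ->] := gamma_log hg x0.
    have [i [k [iP kd h]]] := dual_D_index_exists hp1 hp2 p12 hm a.
    by exists k => //; apply/(mem_dual_D_class hg NF); exists i.
  case: (eqVneq x 0%R) => [->|x0]; first by rewrite (negbTE (dual0 _)).
  have [a ->] := gamma_log hg x0.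
  case/(mem_dual_D_class hg NF)=> i iP hi /(mem_dual_D_class hg NF)[i' i'P hi'].
  exact: (@dual_D_index_inj p1 p2 m hp1 hp2 p12 hm a i k i' k').
have RE k x y : ((x, y) \in fusion_rel g p1 p2 m k) = (kap (x - y)%R == k).
  by rewrite kapE /fusion_rel /colour_class; case: ifP; rewrite inE //= subr_eq0.
have kap0 x : (kap x == ord0) = (x == 0%R) by rewrite kapE /colour_class eqxx.
have kap'0 x : (kap' x == ord0) = (x == 0%R) by rewrite kap'E /colour_class eqxx.
have kapN x : kap (- x)%R = kap x.
  apply/eqP; rewrite kapE; have := eqxx (kap x); rewrite [in X in X -> _]kapE /colour_class.
  by case: ifP => _; [rewrite oppr_eq0 | apply: D_class_opp].
have P0 := P_gt0 m hp1.
have kap_surj k : exists x, kap x = k.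
  case: (eqVneq k ord0) => [->|/negPf k0]; first by exists 0%R; apply/eqP; rewrite kap0.
  (* Colour 0 is reserved for the zero element, so colour [k] is the class [D_(k-1)]; the witness is
     its element with [i = 0]. *)
  exists (val g ^+ (k.-1 * p1 ^ (m - 1)))%R; apply/eqP; rewrite kapE /colour_class k0.
  by apply/(mem_D_class hg NF); exists 0.
have kap'_surj k : exists x, kap' x = k.
  case: (eqVneq k ord0) => [->|/negPf k0]; first by exists 0%R; apply/eqP; rewrite kap'0.
  exists (val g ^+ (k.-1 * p1 ^ (m - 1)))%R; apply/eqP; rewrite kap'E /colour_class k0.
  by apply/(mem_dual_D_class hg NF); exists 0; rewrite ?addn0.
have dual k y y' : kap' y = kap' y' ->
    (\sum_(x | kap x == k) psi (x * y) = \sum_(x | kap x == k) psi (x * y'))%R.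
  move=> yy'; case: (eqVneq k ord0) => [->|/negPf k0].
    by apply: eq_bigr => x; rewrite kap0 => /eqP ->; rewrite !mul0r.
  under eq_bigl => x do rewrite kapE /colour_class k0.
  under [RHS]eq_bigl => x do rewrite kapE /colour_class k0.
  have := eqxx (kap' y'); rewrite -{1}yy'; have := eqxx (kap' y').
  rewrite !kap'E /colour_class; case: ifP => _; first by move=> /eqP -> /eqP ->.
  move=> h' h; exact: (sum_D_class_dual hp1 hp2 p12 hm p1_odd p2_odd hpN op hg NF
    p_char psi_frob _ h h').
split.
  exact: (dual_association_scheme psi0 psiD psi_nt RE kap0 kapN kap_surj kap'_surj dual).
apply: (dual_pseudocyclic psi0 psiD psi_nt RE kap'0 kapN kap_surj kap'_surj dual
  (t := #|D_class g p1 p2 m 0|)) => e /negPf e0.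
rewrite -(card_dual_D_class p1 p2 m g e.-1); congr #|pred_of_set _|.
by apply/setP => y; rewrite inE kap'E /colour_class e0.
Qed.
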